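(* Let $n\ge 3$, let $f\in\mathbb{Q}[s_1,s_2]$ be the polynomial with $f(x+y,xy)=x^{n+1}+y^{n+1}$, and let $$\mathcal{C}'(\text{double loop})_n=\big(J_{f(y,z)}\{4-2n\}\to 0\to J_{f(y,z)}\{4-2n\}\big),\qquad J_{f(y,z)}=\mathbb{Q}[y,z]\big/\big\langle \tfrac{\partial f}{\partial y},\tfrac{\partial f}{\partial z}\big\rangle ,$$ be the matrix factorization (with potential $0$) of the double loop, where $\deg y=2$, $\deg z=4$. Then the Euler characteristic of its homology is $$\overline{\chi}\big(\mathrm{H}(\mathcal{C}'(\text{double loop})_n)\big)=\frac{[n][n-1]}{[2]} .$$
   Context: $[m]=\dfrac{q^m-q^{-m}}{q-q^{-1}}$ is the quantum integer. The right-hand side $[n][n-1]/[2]$ is the value of the $\mathfrak{sl}_n$ quantum link invariant for the double loop, i.e. the quantum dimension of the representation $\wedge^2V$ of $U_q(\mathfrak{sl}_n)$, $V$ being the fundamental representation. The shift $\{m\}$ shifts the $\mathbb{Z}$-grading up by $m$ (an element of degree $d$ becomes of degree $d+m$). A matrix factorization with potential $0$ is a $2$-periodic complex $(M_0\xrightarrow{d_0}M_1\xrightarrow{d_1}M_0)$ of $\mathbb{Z}$-graded modules with $d_1d_0=0$, $d_0d_1=0$; its homology is $\mathbb{Z}\oplus\mathbb{Z}_2$-graded, $\mathrm{H}(\overline M)=\bigoplus_{j\in\mathbb{Z},k\in\mathbb{Z}_2}\mathrm{H}^{j,k}(\overline M)$, where $k\in\{0,1\}$ is the position in the complex and $j$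 is the grading induced from the $\mathbb{Z}$-grading of the modules. The Euler characteristic is $$\overline\chi(\mathrm{H}(\overline M))=\sum_{j\in\mathbb{Z},\,k\in\mathbb{Z}_2}\dim_{\mathbb{Q}}\mathrm{H}^{j,k}(\overline M)\,q^j .$$ In the factorization above $M_0=J_{f(y,z)}\{4-2n\}$ and $M_1=0$. *)

(* Defs.v *)
From HB Require Import structures.
From mathcomp Require Import all_boot all_order all_algebra.
From mathcomp Require Import generic_quotient ring_quotient.
From mathcomp Require Import boolp classical_sets fsbigop.
From mathcomp Require Import mpoly.

Set Implicit Arguments.
Unset Strict Implicit.
Unset Printing Implicit Defensive.

Import Order.TTheory GRing.Theory Num.Theory.
Local Open Scope ring_scope.
Local Open Scope quotient_scope.

(* The library quotients a Z-module by a [zmodClosed] predicate; over a ring,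
   a [submodClosed] predicate is one, but this is not an inheritance there. *)
Definition submod_pred (R : nzRingType) (V : lmodType R) (U : submodClosed V) :
  {pred V} := U.

Lemma submod_pred_zmod_closed (R : nzRingType) (V : lmodType R)
  (U : submodClosed V) : zmod_closed (submod_pred U).
Proof.
split=> [|u v hu hv]; first exact: (rpred0 U).
by rewrite -scaleN1r; apply: (rpredD (S := U)) => //; apply: rpredZ.
Qed.

HB.instance Definition _ (R : nzRingType) (V : lmodType R) (U : submodClosed V) :=
  GRing.isZmodClosed.Build V (submod_pred U) (submod_pred_zmod_closed U).

Local Notation "{ 'quot' U }" := (Quotient.quot (submod_pred U)) : type_scope.

Section QuotientLmodule.
Variables (R : nzRingType) (V : lmodType R) (U : submodClosed V).

Definition qscale (a : R) (x : {quot U}) : {quot U} := \pi_({quot U}) (a *: repr x).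

Lemma qpi_eq (x y : V) :
  (\pi_({quot U}) x == \pi_({quot U}) y) = (x - y \in U).
Proof. by rewrite -Quotient.idealrBE. Qed.

Lemma pi_qscale a (x : V) : qscale a (\pi_({quot U}) x) = \pi_({quot U}) (a *: x).
Proof.
apply/eqP; rewrite qpi_eq -scalerBr; apply: rpredZ.
by rewrite -qpi_eq reprK.
Qed.

Lemma qscaleA a b v : qscale a (qscale b v) = qscale (a * b) v.
Proof. by elim/quotW: v => x; rewrite !(pi_qscale _ x) pi_qscale scalerA. Qed.

Lemma qscale1 : left_id 1 qscale.
Proof. by elim/quotW=> x; rewrite pi_qscale scale1r. Qed.

Lemma qscaleDr : right_distributive qscale +%R.
Proof.
move=> a; elim/quotW=> x; elim/quotW=> y.
by rewrite -raddfD (pi_qscale a x) (pi_qscale a y) pi_qscale scalerDr raddfD.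
Qed.

Lemma qscaleDl v : {morph qscale^~ v : a b / a + b}.
Proof. by move=> a b; elim/quotW: v => x; rewrite !(pi_qscale _ x) scalerDl raddfD. Qed.

HB.instance Definition _ :=
  GRing.Zmodule_isLmodule.Build R {quot U} qscaleA qscale1 qscaleDr qscaleDl.

Lemma pi_scalable : scalable (\pi_({quot U}) : V -> {quot U}).
Proof. by move=> a x; rewrite -pi_qscale. Qed.

End QuotientLmodule.

(* The homogeneous component of degree [j] is [gcomp M j]; the last three
   fields say that these are subspaces whose direct sum is [M]. *)
Record gradedMod := GradedMod {
  gcarrier :> lmodType rat;
  gcomp : int -> set gcarrier;
  gcomp0 : forall j, gcomp j 0;
  gcompP : forall j (a : rat) u v, gcomp j u -> gcomp j v -> gcomp j (a *: u + v);
  gcomp_gen : forall x, exists (s : seq int) (c : int -> gcarrier),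
    [/\ uniq s, forall i, gcomp i (c i) & x = \sum_(i <- s) c i];
  gcomp_indep : forall (s : seq int) (c : int -> gcarrier), uniq s ->
    (forall i, gcomp i (c i)) -> \sum_(i <- s) c i = 0 ->
    forall i, i \in s -> c i = 0
}.

Section Shift.
Variables (M : gradedMod) (m : int).

Definition shift_comp (j : int) : set M := gcomp (j - m).

Lemma shift_gen (x : M) : exists (s : seq int) (c : int -> M),
  [/\ uniq s, forall i, shift_comp i (c i) & x = \sum_(i <- s) c i].
Proof.
have [s [c [us hc ->]]] := gcomp_gen x.
exists [seq i + m | i <- s], (fun i => c (i - m)); split.
- by rewrite map_inj_uniq //; apply: addIr.
- by move=> i; apply: hc.
- by rewrite big_map; apply: eq_bigr => i _; rewrite addrK.
Qed.

Lemma shift_indep (s : seq int) (c : int -> M) : uniq s ->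
  (forall i, shift_comp i (c i)) -> \sum_(i <- s) c i = 0 ->
  forall i, i \in s -> c i = 0.
Proof.
move=> us hc hs i si.
have := @gcomp_indep M [seq i - m | i <- s] (fun i => c (i + m)).
rewrite map_inj_uniq; last exact: addIr.
move=> /(_ us) H; rewrite -[i](subrK m); apply: H.
- by move=> j; have := hc (j + m); rewrite /shift_comp addrK.
- by rewrite big_map -[RHS]hs; apply: eq_bigr => j _; rewrite subrK.
- exact: map_f.
Qed.

Definition shift : gradedMod :=
  GradedMod (fun j => gcomp0 M (j - m)) (fun j => @gcompP M (j - m))
    shift_gen shift_indep.

End Shift.

Section GradedQuotient.
Variables (M : gradedMod) (U : submodClosed M).

Definition graded_submod := forall (s : seq int) (c : int -> M), uniq s ->
  (forall i, gcomp i (c i)) -> \sum_(i <- s) c i \in U ->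
  forall i, i \in s -> c i \in U.

Hypothesis gU : graded_submod.

Definition quot_comp (j : int) : set {quot U} :=
  [set x | exists2 u : M, gcomp j u & x = \pi_({quot U}) u].

Lemma quot_comp0 j : quot_comp j 0.
Proof. by exists 0; [apply: gcomp0 | rewrite raddf0]. Qed.

Lemma quot_compP j (a : rat) u v :
  quot_comp j u -> quot_comp j v -> quot_comp j (a *: u + v).
Proof.
move=> [u' hu ->] [v' hv ->]; exists (a *: u' + v'); first exact: gcompP.
by rewrite raddfD /= pi_scalable.
Qed.

Lemma quot_gen (x : {quot U}) : exists (s : seq int) (c : int -> {quot U}),
  [/\ uniq s, forall i, quot_comp i (c i) & x = \sum_(i <- s) c i].
Proof.
have [s [c [us hc hx]]] := gcomp_gen (repr x).
exists s, (fun i => \pi_({quot U}) (c i)); split => //; first by move=> i; exists (c i).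
by rewrite -[LHS]reprK hx raddf_sum.
Qed.

Lemma quot_indep (s : seq int) (c : int -> {quot U}) : uniq s ->
  (forall i, quot_comp i (c i)) -> \sum_(i <- s) c i = 0 ->
  forall i, i \in s -> c i = 0.
Proof.
move=> us hc hs i si.
have [b hb] := choice (fun i => let: ex_intro2 u h1 h2 := hc i in
                        ex_intro _ u (conj h1 h2)).
have piU u : (\pi_({quot U}) u == 0) = (u \in U).
  by have := qpi_eq U u 0; rewrite raddf0 subr0.
rewrite (hb i).2; apply/eqP; rewrite piU.
apply: (gU us) => // [j|]; first exact: (hb j).1.
rewrite -piU raddf_sum -[X in _ == X]hs; apply/eqP.
by apply: eq_bigr => j _; rewrite [RHS](hb j).2.
Qed.

Definition graded_quot : gradedMod :=
  GradedMod quot_comp0 quot_compP quot_gen quot_indep.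

End GradedQuotient.

Section ZeroModule.

Definition zero_comp (j : int) : set 'rV[rat]_0 := [set: 'rV[rat]_0].

Lemma zero_gen (x : 'rV[rat]_0) : exists (s : seq int) (c : int -> 'rV[rat]_0),
  [/\ uniq s, forall i, zero_comp i (c i) & x = \sum_(i <- s) c i].
Proof. by exists [::], (fun=> 0); split=> //; rewrite [x]thinmx0 [RHS]thinmx0. Qed.

Definition zero_graded : gradedMod :=
  @GradedMod 'rV[rat]_0 zero_comp (fun _ => I) (fun _ _ _ _ _ _ => I) zero_gen
    (fun _ c _ _ _ i _ => thinmx0 (c i)).

End ZeroModule.

(* Q[y, z], with y the variable of index 0 and z the variable of index 1. *)
Local Notation A := {mpoly rat[2]}.

Section GradedPolynomials.

(* degree of the monomial y ^ (m 0) z ^ (m 1) *)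
Definition wdeg (m : 'X_{1..2}) : nat := (2 * m 0%R + 4 * m 1%R)%N.

Lemma wdeg0 : wdeg 0%MM = 0%N.
Proof. by rewrite /wdeg !mnm0E. Qed.

Lemma wdegD m1 m2 : wdeg (m1 + m2)%MM = (wdeg m1 + wdeg m2)%N.
Proof. by rewrite /wdeg !mnmDE !mulnDr addnACA. Qed.

HB.instance Definition _ := isMeasure.Build 2 wdeg wdeg0 wdegD.

Definition poly_comp (j : int) : set A :=
  [set p | {in msupp p, forall m, (wdeg m)%:Z = j}].

Lemma poly_compE j (p : A) :
  poly_comp j p <-> forall m, (wdeg m)%:Z != j -> p@_m = 0.
Proof.
split=> h m.
  by move=> hm; apply/eqP; rewrite mcoeff_eq0; apply: contra hm => /h ->.
by rewrite mcoeff_msupp => hm; apply/eqP; apply: contraNT hm => /h ->.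
Qed.

Lemma poly_comp0 j : poly_comp j 0.
Proof. by apply/poly_compE => m _; rewrite mcoeff0. Qed.

Lemma poly_compP j (a : rat) u v :
  poly_comp j u -> poly_comp j v -> poly_comp j (a *: u + v).
Proof.
move=> /poly_compE hu /poly_compE hv; apply/poly_compE => m hm.
by rewrite mcoeffD mcoeffZ hu // hv // mulr0 addr0.
Qed.

Lemma poly_gen (x : A) : exists (s : seq int) (c : int -> A),
  [/\ uniq s, forall i, poly_comp i (c i) & x = \sum_(i <- s) c i].
Proof.
pose c (i : int) : A := if i is Posz d then pihomog wdeg d x else 0.
exists [seq Posz i | i <- iota 0 (@mmeasure _ _ wdeg x)], c; split.
- by rewrite map_inj_uniq ?iota_uniq // => i j [].
- case=> [d|d] /=; last exact: poly_comp0.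
  by move=> m hm; have /dhomogP/(_ m hm) := pihomogP wdeg d x; move=> /= ->.
- rewrite {1}(@pihomog_partitionE 2 rat wdeg _ x (leqnn _)) big_map.
  by rewrite -(big_mkord xpredT (fun i => pihomog wdeg i x)) /index_iota subn0.
Qed.

Lemma poly_compX m : poly_comp (wdeg m)%:Z 'X_[m].
Proof. by move=> m'; rewrite msuppX inE => /eqP ->. Qed.

Lemma poly_compM i j p q :
  poly_comp i p -> poly_comp j q -> poly_comp (i + j) (p * q).
Proof.
move=> hp hq m /msuppM_le/allpairsP[[m1 m2] /= [h1 h2 ->]].
by rewrite -(hp _ h1) -(hq _ h2) wdegD PoszD.
Qed.

Lemma poly_comp_deriv i (k : 'I_2) p : poly_comp i p ->
  poly_comp (i - (wdeg U_(k)%MM)%:Z) p^`M(k).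
Proof.
move=> /poly_compE hp; apply/poly_compE => m hm.
rewrite mcoeff_deriv hp ?mul0rn //; apply: contra hm => /eqP <-.
by rewrite wdegD PoszD addrK.
Qed.

Definition wproj (j : int) (p : A) : A :=
  if j is Posz d then pihomog wdeg d p else 0.

Lemma wproj_comp i j p : poly_comp i p -> wproj j p = if i == j then p else 0.
Proof.
have [-> hp|p0] := eqVneq p 0; first by case: j => d /=; rewrite ?raddf0 if_same.
move=> hp; have [m hm] : exists m, m \in msupp p.
  by case E: (msupp p) p0 => [|m l]; [rewrite -msupp_eq0 E eqxx | exists m; rewrite inE eqxx].
have hd : p \is (wdeg m).-homog for wdeg.
  by apply/dhomogP => m' /hp h; have := hp _ hm; rewrite -h => -[].
rewrite -(hp _ hm); case: j => [d|d] //=.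
rewrite eqz_nat; case: eqVneq => [<-|ne]; first exact: pihomog_dE.
exact: pihomog_ne0 hd.
Qed.

Lemma wprojP j a p q : wproj j (a *: p + q) = a *: wproj j p + wproj j q.
Proof. by case: j => d /=; rewrite ?linearP // scaler0 addr0. Qed.

Lemma wproj0 j : wproj j 0 = 0.
Proof. by case: j => d //=; rewrite raddf0. Qed.

Lemma wprojM j e h g : poly_comp e g -> wproj (j + e) (h * g) = wproj j h * g.
Proof.
move=> hg; elim/mpolyind: h => [|a m p _ _ IH]; first by rewrite mul0r !wproj0 mul0r.
rewrite mulrDl -scalerAl !wprojP mulrDl IH -scalerAl; congr (_ *: _ + _).
rewrite (wproj_comp _ (poly_compM (@poly_compX m) hg)) (wproj_comp _ (@poly_compX m)).
by rewrite (inj_eq (addIr e)); case: eqP; rewrite ?mul0r.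
Qed.

Lemma wproj_sum (s : seq int) (c : int -> A) : uniq s ->
  (forall i, poly_comp i (c i)) ->
  forall i, i \in s -> wproj i (\sum_(i <- s) c i) = c i.
Proof.
move=> us hc i si; have wD p q : wproj i (p + q) = wproj i p + wproj i q.
  by have := wprojP i 1 p q; rewrite !scale1r.
rewrite (big_morph _ wD (wproj0 i)) (big_rem i) //= (wproj_comp _ (hc i)) eqxx.
rewrite big_seq big1 ?addr0 // => j; rewrite mem_rem_uniq // inE => /andP[ji _].
by rewrite (wproj_comp _ (hc j)) (negPf ji).
Qed.

Lemma poly_indep (s : seq int) (c : int -> A) : uniq s ->
  (forall i, poly_comp i (c i)) -> \sum_(i <- s) c i = 0 ->
  forall i, i \in s -> c i = 0.
Proof. by move=> us hc hs i si; rewrite -(wproj_sum us hc si) hs wproj0. Qed.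

Definition graded_poly : gradedMod :=
  @GradedMod A poly_comp poly_comp0 poly_compP poly_gen poly_indep.

End GradedPolynomials.

Section JacobianAlgebra.
Variable f : A.

Definition jacobian_ideal : {pred A} :=
  fun p => `[< exists a b : A, p = a * f^`M(0) + b * f^`M(1) >].

Lemma jacobian_ideal_closed : submod_closed jacobian_ideal.
Proof.
split=> [|r u v].
  by apply/asboolP; exists 0, 0; rewrite !mul0r addr0.
move=> /asboolP[a [b ->]] /asboolP[a' [b' ->]]; apply/asboolP.
exists (r *: a + a'), (r *: b + b').
by rewrite !mulrDl -!scalerAl scalerDr addrACA.
Qed.

HB.instance Definition _ :=
  GRing.isSubmodClosed.Build rat A jacobian_ideal
    (GRing.submod_closed_semi jacobian_ideal_closed).

Lemma jacobian_ideal_graded (d : int) : poly_comp d f ->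
  graded_submod (M := graded_poly) jacobian_ideal.
Proof.
move=> hf s c us hc /asboolP[a [b hab]] i si; apply/asboolP.
have hy := @poly_comp_deriv d 0 f hf; have hz := @poly_comp_deriv d 1 f hf.
set ey := d - _ in hy; set ez := d - _ in hz.
exists (wproj (i - ey) a), (wproj (i - ez) b).
rewrite -(wproj_sum us hc si) hab -(wprojM _ _ hy) -(wprojM _ _ hz) !subrK.
by have := wprojP i 1 (a * f^`M(0)) (b * f^`M(1)); rewrite !scale1r.
Qed.

(* Q[y, z] / <df/dy, df/dz>, graded by deg y = 2 and deg z = 4 *)
Definition jacobian_algebra (d : int) (hf : poly_comp d f) : gradedMod :=
  graded_quot (jacobian_ideal_graded hf).

End JacobianAlgebra.


(* f (x + y, x y) = x ^ (n + 1) + y ^ (n + 1) *)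
Definition power_sum_poly (n : nat) (f : A) : Prop :=
  f \mPo [tuple 'X_0 + 'X_1; 'X_0 * 'X_1] = 'X_0 ^+ n.+1 + 'X_1 ^+ n.+1 :> A.

Lemma power_sum_poly_homog n f : power_sum_poly n f -> poly_comp (2 * n.+1)%:Z f.
Proof.
move=> hf.
have hS : [tuple mesym 2 rat i.+1 | i < 2] = [tuple 'X_0 + 'X_1; 'X_0 * 'X_1].
  apply/eq_from_tnth => i; rewrite tnth_mktuple.
  case: i => [[|[|//]] hi]; rewrite (tnth_nth 0) /=.
    by rewrite mesym1E !big_ord_recl big_ord0 addr0; congr ('X_ _ + 'X_ _); apply/val_inj.
  by rewrite mesymnnE !big_ord_recl big_ord0 mulr1; congr ('X_ _ * 'X_ _); apply/val_inj.
have hX (i : 'I_2) : ('X_i ^+ n.+1 : A) \is n.+1.-homog.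
  have h : ('X_i : A) \is 1.-homog by rewrite dhomogX /= mdeg1.
  by have := dhomogMn n.+1 h; rewrite mul1n.
have : f \is (n.+1).-homog for mnmwgt.
  by rewrite mwmwgt_homogE hS hf; apply: dhomogD; apply: hX.
move=> /dhomogP h m /h /= <-; congr Posz.
rewrite /wdeg /mnmwgt !big_ord_recl big_ord0 /= addn0 muln1 mulnDr.
by rewrite mulnCA (mulnC _ 4); congr (2 * m _ + 4 * m _)%N; apply/val_inj.
Qed.

Definition homogeneous_map (M N : gradedMod) (d : M -> N) : Prop :=
  exists e : int, forall j x, gcomp j x -> gcomp (j + e) (d x).

(* A matrix factorization with potential 0. No specific degree is imposed on
   the differentials, only that each is homogeneous of some degree, so that the
   homology inherits a grading. *)
Record mfact0 := MFact0 {
  mf0 : gradedMod;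
  mf1 : gradedMod;
  mfd0 : {linear mf0 -> mf1};
  mfd1 : {linear mf1 -> mf0};
  mfd0_homog : homogeneous_map mfd0;
  mfd1_homog : homogeneous_map mfd1;
  mfd1d0 : forall x, mfd1 (mfd0 x) = 0;
  mfd0d1 : forall x, mfd0 (mfd1 x) = 0
}.

Section Homology.
Variables (L M N : gradedMod) (e : {linear L -> M}) (d : {linear M -> N}).

Definition ker_pred : {pred M} := fun x => d x == 0.

Lemma ker_closed : submod_closed ker_pred.
Proof.
split=> [|a u v]; rewrite !unfold_in ?linear0 //.
by move=> /eqP hu /eqP hv; rewrite linearP hu hv scaler0 addr0.
Qed.

HB.instance Definition _ :=
  GRing.isSubmodClosed.Build rat M ker_pred (GRing.submod_closed_semi ker_closed).

Record ker := Ker { ker_val :> M; _ : ker_val \in ker_pred }.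

HB.instance Definition _ := [isSub for ker_val].
HB.instance Definition _ := [Choice of ker by <:].
HB.instance Definition _ := [SubChoice_isSubLmodule of ker by <:].

Definition im_pred : {pred ker} := fun x => `[< exists u, val x = e u >].

Lemma im_closed : submod_closed im_pred.
Proof.
split=> [|a x y]; first by apply/asboolP; exists 0; rewrite !linear0.
move=> /asboolP[u hu] /asboolP[v hv]; apply/asboolP.
by exists (a *: u + v); rewrite [RHS]linearP -hu -hv; apply: linearP.
Qed.

HB.instance Definition _ :=
  GRing.isSubmodClosed.Build rat ker im_pred (GRing.submod_closed_semi im_closed).

(* ker d / im e *)
Definition homology : lmodType rat := {quot im_pred}.

Definition homology_comp (j : int) : set homology :=
  [set h | exists2 x : ker, gcomp j (val x) & h = \pi_({quot im_pred}) x].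

End Homology.

Arguments homology_comp {L M N} e d j.

(* The dimension of a finite-dimensional subspace; 0 by convention on
   subspaces of infinite dimension. *)
Definition dimQ (V : lmodType rat) (U : set V) : nat :=
  xget 0%N [set d | exists b : 'I_d -> V,
    [/\ forall i, U (b i),
        forall c : 'I_d -> rat, \sum_i c i *: b i = 0 -> forall i, c i = 0
      & forall x, U x -> exists c : 'I_d -> rat, x = \sum_i c i *: b i]].

Definition dimH (C : mfact0) (j : int) (k : 'Z_2) : nat :=
  if k == 0 then dimQ (homology_comp (mfd1 C) (mfd0 C) j)
  else dimQ (homology_comp (mfd0 C) (mfd1 C) j).

(* Euler characteristics and quantum integers live in Q(q). *)
Definition Qq := {fraction {poly rat}}.
Definition qvar : Qq := tofrac 'X.

(* [\sum_(j \in _)] is a finitely supported sum: 0 if the support is infinite. *)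
Definition euler_char (C : mfact0) : Qq :=
  \sum_(j \in [set: int]) \sum_(k : 'Z_2) (dimH C j k)%:R * qvar ^ j.

Definition qint (m : int) : Qq := (qvar ^ m - qvar ^ (- m)) / (qvar - qvar^-1).

Section DoubleLoop.
Variables (n : nat) (f : A) (hf : power_sum_poly n f).

Definition J_shifted : gradedMod :=
  shift (jacobian_algebra (power_sum_poly_homog hf)) (4 - 2 * n%:Z).

Lemma null_homog (M N : gradedMod) : homogeneous_map (\0 : {linear M -> N}).
Proof. by exists 0 => j x _; apply: gcomp0. Qed.

Definition double_loop : mfact0 :=
  @MFact0 J_shifted zero_graded \0 \0 (@null_homog _ _) (@null_homog _ _)
    (fun _ => erefl) (fun _ => erefl).

End DoubleLoop.

(* Main.v *)
(* In the roots x0, x1 with y = x0 + x1 and z = x0 * x1, the chain rule gives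
   (x0 - x1) f_y = (n + 1) (x0^(n+1) - x1^(n+1)) and
   (x0 - x1) f_z = (n + 1) (x1^n - x0^n), so f_y and f_z are nonzero multiples
   of the complete symmetric polynomials h_n and h_(n-1).  The products z^b h_m
   span Q[y, z]; by the recursion h_(m+2) = y h_(m+1) - z h_m, those with
   b + m >= n - 1 lie in the Jacobian ideal.  The others are independent modulo
   it: multiplying by x0 - x1 turns z^b h_m into the antisymmetrisation of
   x0^(b+m+1) x1^b, whose exponents are less than n, and sends the ideal into
   (x0^n, x1^n).  Hence the z^b h_m with b + m <= n - 2, of degree 2m + 4b, form
   a basis of the Jacobian algebra, and its Hilbert series is
   (1 - q^(2n)) (1 - q^(2n-2)) / ((1 - q^2) (1 - q^4)). *)
Require Import Defs.
From mathcomp Require Import all_boot all_order all_algebra.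
From mathcomp Require Import boolp classical_sets fsbigop.
From mathcomp Require Import mpoly ring.
From mathcomp Require Import zify.

Set Implicit Arguments.
Unset Strict Implicit.
Unset Printing Implicit Defensive.

Import Order.TTheory GRing.Theory Num.Theory.
Local Open Scope ring_scope.

Local Notation A := {mpoly rat[2]}.

(** * The chain rule for polynomial composition *)

Lemma mderivXU (R : comNzRingType) (n : nat) (i j : 'I_n) :
  ('X_i : {mpoly R[n]})^`M(j) = (i == j)%:R.
Proof.
rewrite mderivX mnm1E; case: eqVneq => [->|_]; last by rewrite scale0r.
by rewrite scale1r -{1}[U_(j)%MM]add0m addmK mpolyX0.
Qed.

(** Both sides are linear in [p] and obey the same Leibniz rule, so everything reduces to the
    variables. *)
Lemma mderiv_comp (R : comNzRingType) (n k : nat) (t : n.-tuple {mpoly R[k]})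
    (p : {mpoly R[n]}) (i : 'I_k) :
  (p \mPo t)^`M(i) = \sum_(j < n) (p^`M(j) \mPo t) * (tnth t j)^`M(i).
Proof.
pose P (p : {mpoly R[n]}) :=
  (p \mPo t)^`M(i) = \sum_(j < n) (p^`M(j) \mPo t) * (tnth t j)^`M(i).
have PM (q r : {mpoly R[n]}) : P q -> P r -> P (q * r).
  move=> hq hr; rewrite /P rmorphM mderivM hq hr mulr_suml mulr_sumr -big_split.
  apply: eq_bigr => j _; rewrite mderivM rmorphD !rmorphM /=; ring.
have P1 : P 1.
  rewrite /P comp_mpoly1 -mpolyC1 mderivC big1 // => j _.
  by rewrite mderivC comp_mpoly0 mul0r.
elim/mpolyind: p => [|c m p _ _ IH].
  by rewrite comp_mpoly0 mderiv0 big1 // => j _; rewrite mderiv0 comp_mpoly0 mul0r.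
have PX : P 'X_[m].
  rewrite (mpolyXE_id _ m); apply: (big_ind P) => // l _.
  elim: (m l) => [|e IHe]; first by rewrite expr0.
  rewrite exprS; apply: PM IHe; rewrite /P [_ \mPo _]comp_mpolyXU -tnth_nth.
  rewrite (bigD1 l) //= big1 ?addr0 => [|j jl].
    by rewrite mderivXU eqxx comp_mpoly1 mul1r.
  by rewrite mderivXU eq_sym (negPf jl) comp_mpoly0 mul0r.
rewrite comp_mpolyD comp_mpolyZ mderivD mderivZ IH PX scaler_sumr -big_split /=.
apply: eq_bigr => j _; rewrite mderivD mderivZ comp_mpolyD comp_mpolyZ.
by rewrite mulrDl scalerAl.
Qed.

(** * Passage to the roots x0, x1, and Schur polynomials *)

Definition esym2 : 2.-tuple A := [tuple 'X_0 + 'X_1; 'X_0 * 'X_1].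

(** The Vandermonde factor makes the result antisymmetric, so that Schur polynomials become
    differences of two monomials. *)
Definition alt (p : A) : A := (p \mPo esym2) * ('X_0 - 'X_1).

Lemma esym2E : esym2 = [tuple mesym 2 rat i.+1 | i < 2].
Proof.
apply/eq_from_tnth => i; rewrite tnth_mktuple.
case: i => [[|[|//]] hi]; rewrite (tnth_nth 0) /=.
  by rewrite mesym1E !big_ord_recl big_ord0 addr0; congr ('X_ _ + 'X_ _); apply/val_inj.
by rewrite mesymnnE !big_ord_recl big_ord0 mulr1; congr ('X_ _ * 'X_ _); apply/val_inj.
Qed.

(** The Vandermonde factor cancels in a domain, and the elementary symmetric polynomials are
    algebraically independent. *)
Lemma alt_inj : injective alt.
Proof.
move=> p q; rewrite /alt => /(mulIf _) h.
have {}/h : 'X_0 - 'X_1 != 0 :> A.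
  rewrite subr_eq0; apply/eqP => /(congr1 (mcoeff U_(0%R)%MM)) /eqP.
  by rewrite !mcoeffXU.
by rewrite esym2E => /msym_fundamental_un.
Qed.

Lemma altD p q : alt (p + q) = alt p + alt q.
Proof. by rewrite /alt raddfD mulrDl. Qed.

Lemma altB p q : alt (p - q) = alt p - alt q.
Proof. by rewrite /alt raddfB mulrBl. Qed.

Lemma altZ c p : alt (c *: p) = c *: alt p.
Proof. by rewrite /alt comp_mpolyZ scalerAl. Qed.

Lemma altM p q : alt (p * q) = (p \mPo esym2) * alt q.
Proof. by rewrite /alt rmorphM mulrA. Qed.

(* h_k(x0, x1), written in the elementary symmetric polynomials. *)
Fixpoint hsym (k : nat) : A :=
  if k is k'.+1 then
    (if k' is k''.+1 then 'X_0 * hsym k' - 'X_1 * hsym k'' else 'X_0)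
  else 1.

Lemma hsymSS k : hsym k.+2 = 'X_0 * hsym k.+1 - 'X_1 * hsym k.
Proof. by []. Qed.

Lemma alt_hsym k : alt (hsym k) = 'X_0 ^+ k.+1 - 'X_1 ^+ k.+1.
Proof.
have c0 : 'X_0 \mPo esym2 = 'X_0 + 'X_1 :> A by rewrite comp_mpolyXU.
have c1 : 'X_1 \mPo esym2 = 'X_0 * 'X_1 :> A by rewrite comp_mpolyXU.
(* The recursion has order two, so two consecutive indices are carried through the induction. *)
suff: alt (hsym k) = 'X_0 ^+ k.+1 - 'X_1 ^+ k.+1 /\
  alt (hsym k.+1) = 'X_0 ^+ k.+2 - 'X_1 ^+ k.+2 by case.
elim: k => [|k [IH0 IH1]].
  by split; rewrite /alt /= ?comp_mpoly1 ?c0; ring.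
split=> //; rewrite hsymSS altB !altM c0 c1 IH0 IH1.
by rewrite !(exprS _ k.+2) !(exprS _ k.+1); ring.
Qed.

(** The Schur polynomial of the partition (b + m, b), in terms of y and z. *)
Definition schur (b m : nat) : A := 'X_1 ^+ b * hsym m.

Lemma alt_schur b m :
  alt (schur b m) = 'X_0 ^+ (b + m.+1) * 'X_1 ^+ b - 'X_0 ^+ b * 'X_1 ^+ (b + m.+1).
Proof.
rewrite /schur altM alt_hsym rmorphXn /= comp_mpolyXU /= exprMn !exprD; ring.
Qed.

(** The Pieri rule for two rows: multiplying by y adds a box to either row. *)
Lemma X0_schur b m : 'X_0 * schur b m.+1 = schur b m.+2 + schur b.+1 m.
Proof. by rewrite /schur hsymSS exprS; ring. Qed.

(** * The partial derivatives of f in the roots *)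

Section PowerSum.
Variables (n : nat) (f : A).
Hypothesis hf : power_sum_poly n f.

(** Differentiate the defining identity of [f] in the root x_i: y has derivative 1, and z has the
    other root x_j as derivative. *)
Lemma power_sum_deriv (i j : 'I_2) : i != j ->
  (f^`M(0) \mPo esym2) + (f^`M(1) \mPo esym2) * 'X_j = n.+1%:R * 'X_i ^+ n.
Proof.
have dXn (a b : 'I_2) k : ('X_a ^+ k.+1 : A)^`M(b) = (a == b)%:R * (k.+1%:R * 'X_a ^+ k).
  elim: k => [|k IH]; first by rewrite expr1 mderivXU; ring.
  by rewrite exprS mderivM mderivXU IH -(@natr1 _ k.+1) exprS; ring.
move=> ij; have := congr1 (mderiv i) hf; rewrite mderiv_comp.
rewrite !mderivD !dXn 2!big_ord_recl big_ord0 !(tnth_nth 0) /=.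
rewrite mderivD mderivM !mderivXU addr0.
have -> : (ord0 : 'I_2) = 0 by [].
have -> : lift ord0 ord0 = 1 :> 'I_2 by apply/val_inj.
by case: i j ij => [[|[|//]] hi] [[|[|//]] hj] //= _;
  rewrite /eq_op /= /eq_op /= => h;
  [have -> : Ordinal hj = 1 by [apply/val_inj]; have -> : Ordinal hi = 0 by [apply/val_inj] |
   have -> : Ordinal hj = 0 by [apply/val_inj]; have -> : Ordinal hi = 1 by [apply/val_inj]];
  move: h; rewrite !(mul1r, mul0r, mulr1, mulr0, add0r, addr0).
Qed.

End PowerSum.

(** * Multiples in the ideal, and coefficients in two variables *)

Lemma jacobian_idealM f p q :
  q \in jacobian_ideal f -> p * q \in jacobian_ideal f.
Proof.
move=> /asboolP[a [b ->]]; apply/asboolP; exists (p * a), (p * b).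
by rewrite mulrDr !mulrA.
Qed.

Lemma mcoeff_MXn_small (R : comNzRingType) (n k : nat) (i : 'I_n)
    (p : {mpoly R[n]}) (m : 'X_{1..n}) :
  (m i < k)%N -> (p * 'X_i ^+ k)@_m = 0.
Proof.
move=> hm; apply/eqP; rewrite mpolyXn mcoeff_eq0 (perm_mem (msuppMX _ _)).
apply/mapP => -[m' _ hm']; move: hm.
by rewrite hm' mnmDE mulmnE mnm1E eqxx mul1n ltnNge leq_addr.
Qed.

Definition mnm2 (i j : nat) : 'X_{1..2} := (U_(0%R) *+ i + U_(1%R) *+ j)%MM.

Lemma mnm2_0 i j : mnm2 i j 0 = i.
Proof. by rewrite mnmDE !mulmnE !mnm1E /= mul1n mul0n addn0. Qed.

Lemma mnm2_1 i j : mnm2 i j 1 = j.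
Proof. by rewrite mnmDE !mulmnE !mnm1E /= mul1n mul0n. Qed.

Lemma mpolyX_mnm2 i j : 'X_[mnm2 i j] = 'X_0 ^+ i * 'X_1 ^+ j :> A.
Proof. by rewrite mpolyXD !mpolyXn. Qed.

Lemma mnm2E (m : 'X_{1..2}) : m = mnm2 (m 0) (m 1).
Proof.
apply/mnmP => -[[|[|//]] hi].
  by rewrite (_ : Ordinal hi = 0) ?mnm2_0 //; apply/val_inj.
by rewrite (_ : Ordinal hi = 1) ?mnm2_1 //; apply/val_inj.
Qed.

Lemma mnm2_eq i j i' j' : (mnm2 i j == mnm2 i' j') = (i == i') && (j == j').
Proof.
apply/eqP/andP => [h|[/eqP-> /eqP->] //].
by rewrite -(mnm2_0 i j) -{2}(mnm2_1 i j) h mnm2_0 mnm2_1 !eqxx.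
Qed.

(** The condition [j < i] discards the second monomial of the antisymmetrisation, so the leading
    monomial identifies the pair (b, m). *)
Lemma mcoeff_alt_schur b m i j : (j < i)%N ->
  (alt (schur b m))@_(mnm2 i j) = ((i == b + m.+1)%N && (j == b))%:R.
Proof.
move=> ji; rewrite alt_schur -!mpolyX_mnm2 mcoeffB !mcoeffX !mnm2_eq.
have -> : (b == i) && (b + m.+1 == j)%N = false by lia.
by rewrite subr0 eq_sym [b == j]eq_sym.
Qed.

(** * Schur polynomials modulo the Jacobian ideal, with n = k + 2 *)

Section Ideal.
Variables (k : nat) (f : A).
Hypothesis hf : power_sum_poly k.+2 f.

(** Subtracting the two chain-rule identities eliminates f_y. *)
Lemma alt_deriv_z : alt f^`M(1) = k.+3%:R * ('X_1 ^+ k.+2 - 'X_0 ^+ k.+2).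
Proof.
have h0 := power_sum_deriv hf (isT : 0 != 1 :> 'I_2).
have h1 := power_sum_deriv hf (isT : 1 != 0 :> 'I_2).
by rewrite mulrBr -h0 -h1 /alt; ring.
Qed.

(** Weighting the two identities by x0 and x1 before subtracting eliminates f_z. *)
Lemma alt_deriv_y : alt f^`M(0) = k.+3%:R * ('X_0 ^+ k.+3 - 'X_1 ^+ k.+3).
Proof.
have h0 := power_sum_deriv hf (isT : 0 != 1 :> 'I_2).
have h1 := power_sum_deriv hf (isT : 1 != 0 :> 'I_2).
rewrite mulrBr !(exprS _ k.+2) mulrCA [X in _ - X]mulrCA -h0 -h1 /alt; ring.
Qed.

Lemma hsym_ideal m : (k < m)%N -> hsym m \in jacobian_ideal f.
Proof.
have natA j : (j%:R : A) = (j%:R : rat)%:MP by rewrite mpolyC_nat.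
have h1 : hsym k.+1 = (- (k.+3%:R)^-1) *: f^`M(1).
  apply: alt_inj; rewrite altZ alt_hsym alt_deriv_z natA mul_mpolyC scalerA.
  by rewrite mulNr mulVf ?pnatr_eq0 // scaleN1r opprB.
have h2 : hsym k.+2 = (k.+3%:R)^-1 *: f^`M(0).
  apply: alt_inj; rewrite altZ alt_hsym alt_deriv_y natA mul_mpolyC scalerA.
  by rewrite mulVf ?pnatr_eq0 // scale1r.
have i1 : hsym k.+1 \in jacobian_ideal f.
  by rewrite h1 rpredZ //; apply/asboolP; exists 0, 1; rewrite mul0r mul1r add0r.
have i2 : hsym k.+2 \in jacobian_ideal f.
  by rewrite h2 rpredZ //; apply/asboolP; exists 1, 0; rewrite mul0r mul1r addr0.
move=> km; rewrite -(subnKC km); move: (m - _)%N => {km}m.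
suff: hsym (k.+1 + m) \in jacobian_ideal f /\ hsym (k.+1 + m).+1 \in jacobian_ideal f by case.
elim: m => [|m [IH0 IH1]]; first by rewrite addn0.
rewrite addnS; split=> //; rewrite hsymSS -scaleN1r.
by apply: rpredD; rewrite ?rpredZ ?jacobian_idealM.
Qed.

(** The Pieri rule trades a factor z for terms with smaller [b], never lowering b + m; the induction
    ends at [hsym_ideal]. *)
Lemma schur_ideal b m : (k < b + m)%N -> schur b m \in jacobian_ideal f.
Proof.
elim: b m => [|b IH] m hm; first by rewrite /schur mul1r hsym_ideal.
have -> : schur b.+1 m = 'X_0 * schur b m.+1 + (-1) *: schur b m.+2.
  by rewrite X0_schur scaleN1r addrAC subrr add0r.
apply: rpredD; first by apply: jacobian_idealM; apply: IH; lia.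
by apply: rpredZ; apply: IH; lia.
Qed.

(** [alt] maps the ideal into (x0^n, x1^n), whose members have no monomial with both exponents below
    n. *)
Lemma alt_ideal_coeff p i j : p \in jacobian_ideal f ->
  (i < k.+2)%N -> (j < k.+2)%N -> (alt p)@_(mnm2 i j) = 0.
Proof.
move=> /asboolP[a [b ->]] hi hj.
rewrite altD !altM alt_deriv_y alt_deriv_z !(exprS _ k.+2).
set u := _ \mPo _; set v := _ \mPo _; set N := _%:R.
rewrite [X in X@__](_ : _ = (u * N * 'X_0 - v * N) * 'X_0 ^+ k.+2 +
                     (v * N - u * N * 'X_1) * 'X_1 ^+ k.+2); last by ring.
by rewrite mcoeffD !mcoeff_MXn_small ?mnm2_0 ?mnm2_1 ?addr0.
Qed.

(* In degree [2 * d] the elements z^b h_m have [m = d - 2 * b], so [b <= d./2],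
   and [b + m <= k] reads [d - k <= b], where [k = n - 2]; the truncation of
   the subtraction is harmless. *)
Lemma schur_indep d (c : 'I_(d./2.+1 - (d - k)) -> rat) :
  \sum_i c i *: schur (d - k + i) (d - 2 * (d - k + i)) \in jacobian_ideal f ->
  forall i, c i = 0.
Proof.
move=> hI i; have hi := ltn_ord i; set b := (d - k + i)%N.
(* The monomial x0^(d - b + 1) x1^b leads the [i]-th summand and occurs in no other; its exponents
   are below k + 2 because d - k <= b <= d./2. *)
have := alt_ideal_coeff (i := d - b + 1) (j := b) hI.
have altS := big_morph alt altD (_ : alt 0 = 0).
rewrite altS; last by rewrite /alt comp_mpoly0 mul0r.
rewrite raddf_sum (bigD1 i) //= big1 ?addr0 => [|i' ii'].
  rewrite altZ mcoeffZ mcoeff_alt_schur; last by rewrite /b; lia.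
  rewrite (_ : _ && _) ?mulr1 => [->|] //; rewrite /b ?eqxx; lia.
rewrite altZ mcoeffZ mcoeff_alt_schur; last by rewrite /b; lia.
rewrite eqn_add2l andbC (_ : _ == _ = false) ?mulr0 //.
by apply/negbTE; rewrite eq_sym.
Qed.
End Ideal.

(** * Schur polynomials span the graded components *)

(** Here [d] is half the degree: y counts 1 and z counts 2. Coefficients indexed by [nat] can be
    reindexed freely. *)
Definition schur_span (d : nat) (p : A) : Prop :=
  exists c : nat -> rat, p = \sum_(b < d./2.+1) c b *: schur b (d - 2 * b).

Lemma schur_span0 d : schur_span d 0.
Proof. by exists (fun=> 0); rewrite big1 // => b _; rewrite scale0r. Qed.

Lemma schur_spanD d p q : schur_span d p -> schur_span d q -> schur_span d (p + q).
Proof.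
move=> [c ->] [c' ->]; exists (fun b => c b + c' b).
by rewrite -big_split; apply: eq_bigr => b _; rewrite scalerDl.
Qed.

Lemma schur_spanZ d a p : schur_span d p -> schur_span d (a *: p).
Proof.
move=> [c ->]; exists (fun b => a * c b).
by rewrite scaler_sumr; apply: eq_bigr => b _; rewrite scalerA.
Qed.

Lemma schur_span_schur b m : schur_span (m + 2 * b) (schur b m).
Proof.
have hb : (b < (m + 2 * b)./2.+1)%N by lia.
exists (fun i => (i == b)%:R); rewrite (bigD1 (Ordinal hb)) //= eqxx scale1r.
rewrite addnK big1 ?addr0 // => i; rewrite -val_eqE /= => /negPf ->.
by rewrite scale0r.
Qed.

Lemma schur_spanX0 d p : schur_span d p -> schur_span d.+1 ('X_0 * p).
Proof.
move=> [c ->]; rewrite mulr_sumr.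
apply: (big_ind (schur_span d.+1)); [exact: schur_span0|exact: schur_spanD|].
move=> [b /= hb] _; rewrite -scalerAr; apply: schur_spanZ.
(* For m = 0 the Pieri rule loses its second term, as h_1 = y. *)
case E: (d - 2 * b)%N => [|m].
  have -> : 'X_0 * schur b 0 = schur b 1 by rewrite /schur mulr1 mulrC.
  by have -> : d.+1 = (1 + 2 * b)%N; [lia | apply: schur_span_schur].
rewrite X0_schur; apply: schur_spanD.
  by have -> : d.+1 = (m.+2 + 2 * b)%N; [lia | apply: schur_span_schur].
by have -> : d.+1 = (m + 2 * b.+1)%N; [lia | apply: schur_span_schur].
Qed.

Lemma schur_span_mnm a b : schur_span (a + 2 * b) 'X_[mnm2 a b].
Proof.
rewrite mpolyX_mnm2; elim: a => [|a IH].
  by have := schur_span_schur b 0; rewrite /schur mulr1 mul1r.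
by rewrite exprS -mulrA addSn; apply: schur_spanX0.
Qed.

Lemma poly_comp_span d u : poly_comp (2 * d)%N%:Z u -> schur_span d u.
Proof.
move=> hu; rewrite [u]mpolyE big_seq.
apply: (big_ind (schur_span d)); [exact: schur_span0|exact: schur_spanD|].
move=> m /hu [hm]; apply: schur_spanZ; rewrite [m]mnm2E.
have -> : d = (m 0%R + 2 * m 1%R)%N by move: hm; rewrite /wdeg; lia.
exact: schur_span_mnm.
Qed.

Lemma schur_comp b m : poly_comp (2 * (m + 2 * b))%N%:Z (schur b m).
Proof.
have X0c : poly_comp 2 'X_0.
  by move=> m'; rewrite msuppX inE => /eqP ->; rewrite /wdeg !mnm1E.
have X1c : poly_comp 4 'X_1.
  by move=> m'; rewrite msuppX inE => /eqP ->; rewrite /wdeg !mnm1E.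
have c1 : poly_comp 0 1.
  by rewrite -mpolyX0 => m'; rewrite msuppX inE => /eqP ->; rewrite wdeg0.
have hc j : poly_comp (2 * j)%N%:Z (hsym j) /\ poly_comp (2 * j.+1)%N%:Z (hsym j.+1).
  elim: j => [|j [IH0 IH1]]; first by split; [apply: c1|apply: X0c].
  split=> //; rewrite hsymSS addrC -scaleN1r; apply: poly_compP.
    by have := poly_compM X1c IH0; congr (poly_comp _ _); lia.
  by have := poly_compM X0c IH1; congr (poly_comp _ _); lia.
rewrite /schur; elim: b => [|b IH].
  by rewrite mul1r muln0 addn0; case: (hc m).
rewrite exprS -mulrA; have := poly_compM X1c IH; congr (poly_comp _ _); lia.
Qed.

(** The case l > D is included: the truncated subtraction then gives an empty sum. *)
Lemma sum_ord_drop (V : nmodType) (D l : nat) (F : nat -> V) :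
  (forall b, (b < l)%N -> F b = 0) ->
  \sum_(b < D) F b = \sum_(i < D - l) F (l + i)%N.
Proof.
move=> F0; have [lD|Dl] := leqP l D.
  move: (D - l)%N (subnKC lD) => e <-; rewrite big_split_ord /= big1 ?add0r // => i _.
  exact: F0.
have -> : (D - l = 0)%N by lia.
by rewrite big_ord0 big1 // => i _; apply: F0; have := ltn_ord i; lia.
Qed.

Lemma poly_comp_eq0 j (u : A) :
  (forall d : nat, j <> (2 * d)%N%:Z) -> poly_comp j u -> u = 0.
Proof.
move=> hj hu; apply/mpolyP => m; rewrite mcoeff0; apply/eqP.
rewrite mcoeff_eq0; apply/negP => /hu hm.
by apply: (hj (m 0%R + 2 * m 1%R)%N); rewrite -hm /wdeg; lia.
Qed.

(** * Dimensions, graded quotients and homology with zero differentials *)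

(** The predicate from which [dimQ] selects its value. *)
Definition has_basis (V : lmodType rat) (U : set V) (d : nat) : Prop :=
  exists b : 'I_d -> V,
    [/\ forall i, U (b i),
        forall c : 'I_d -> rat, \sum_i c i *: b i = 0 -> forall i, c i = 0
      & forall x, U x -> exists c : 'I_d -> rat, x = \sum_i c i *: b i].

(** The two transition matrices multiply to the identity of size [d], which cannot factor through a
    smaller size. *)
Lemma has_basis_leq (V : lmodType rat) (U : set V) d d' :
  has_basis U d -> has_basis U d' -> (d <= d')%N.
Proof.
move=> [b [bU bfree bgen]] [b' [b'U _ b'gen]].
have [M hM] := choice (fun i => b'gen _ (bU i)).
have [N hN] := choice (fun j => bgen _ (b'U j)).
have : (\matrix_(i, j) M i j) *m (\matrix_(j, l) N j l) = 1%:M.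
  apply/matrixP => i l; rewrite !mxE; under eq_bigr do rewrite !mxE.
  apply/eqP; rewrite -subr_eq0; apply/eqP.
  (* Row [i] of the product minus the identity gives a vanishing combination of the free family
     [b]. *)
  apply: (bfree (fun l => \sum_j M i j * N j l - (i == l)%:R)).
  under eq_bigr do rewrite scalerBl scaler_suml.
  rewrite sumrB exchange_big [X in _ - X](bigD1 i) //= eqxx scale1r.
  rewrite [X in b i + X]big1 ?addr0 => [|l' /negPf li]; last first.
    by rewrite eq_sym li scale0r.
  rewrite [X in _ - X]hM -sumrB big1 // => j _.
  rewrite hN scaler_sumr -sumrB big1 // => l' _.
  by rewrite scalerA subrr.
exact: mulmx1_min.
Qed.

Lemma dimQ_basis (V : lmodType rat) (U : set V) d : has_basis U d -> dimQ U = d.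
Proof.
move=> h; apply: xget_unique => // d' h'.
by apply/eqP; rewrite eqn_leq !(@has_basis_leq _ U).
Qed.

Lemma has_basis0 (V : lmodType rat) (U : set V) :
  (forall x, U x -> x = 0) -> has_basis U 0.
Proof.
move=> U0; exists (fun=> 0); split=> [[]//|c _ []//|x /U0 ->].
by exists (fun=> 0); rewrite big_ord0.
Qed.

Lemma graded_quot_basis (M : gradedMod) (U : submodClosed M)
    (gU : graded_submod U) (j : int) (d : nat) (b : 'I_d -> M) :
  (forall i, gcomp j (b i)) ->
  (forall c : 'I_d -> rat, \sum_i c i *: b i \in U -> forall i, c i = 0) ->
  (forall u, gcomp j u ->
     exists c : 'I_d -> rat, u - \sum_i c i *: b i \in U) ->
  has_basis (@gcomp (graded_quot gU) j) d.
Proof.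
move=> bj bfree bgen.
have piS (c : 'I_d -> rat) :
    \sum_i c i *: (\pi_(Quotient.quot (submod_pred U))%qT (b i)) =
    \pi_(Quotient.quot (submod_pred U))%qT (\sum_i c i *: b i).
  by rewrite raddf_sum; apply: eq_bigr => i _; exact/esym/pi_scalable.
exists (fun i => \pi_(Quotient.quot (submod_pred U))%qT (b i)); split.
- by move=> i; exists (b i).
- move=> c; rewrite piS => h; apply: bfree.
  by rewrite -[X in X \in _]subr0 -qpi_eq h raddf0.
- move=> _ [u /bgen[c hc] ->]; exists c; apply/eqP.
  by rewrite piS qpi_eq.
Qed.

(** Every element is a cycle and only 0 is a boundary, so the homology is [M] itself. *)
Lemma homology0_basis (L M N : gradedMod) (j : int) (d : nat) :
  has_basis (@gcomp M j) d ->
  has_basis (homology_comp (\0 : {linear L -> M}) (\0 : {linear M -> N}) j) d.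
Proof.
move=> [b [bj bfree bgen]].
have kerP x : x \in ker_pred (\0 : {linear M -> N}) by rewrite unfold_in.
pose K x := Ker (kerP x).
pose Q := Quotient.quot (submod_pred (im_pred (\0 : {linear L -> M}) (d := (\0 : {linear M -> N})))).
have valS (c : 'I_d -> rat) : val (\sum_i c i *: K (b i)) = \sum_i c i *: b i.
  by rewrite raddf_sum; apply: eq_bigr => i _; exact: GRing.valZ.
have piS (c : 'I_d -> rat) :
    \sum_i c i *: (\pi_Q%qT (K (b i))) = \pi_Q%qT (\sum_i c i *: K (b i)).
  by rewrite raddf_sum; apply: eq_bigr => i _; exact/esym/pi_scalable.
exists (fun i => \pi_Q%qT (K (b i))); split.
- by move=> i; exists (K (b i)); first exact: bj.
- move=> c; rewrite piS => h; apply: bfree; rewrite -valS.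
  have : \pi_Q%qT (\sum_i c i *: K (b i)) == \pi_Q%qT 0 by rewrite h raddf0.
  by rewrite qpi_eq subr0 => /asboolP[u ->].
- move=> _ [x /bgen[c hc] ->]; exists c; rewrite piS; congr (\pi_Q%qT _).
  by apply/val_inj; rewrite valS.
Qed.

(** * Dimensions of the Jacobian algebra and of the homology *)

Section JacobianDimension.
Variables (k : nat) (f : A).
Hypothesis hf : power_sum_poly k.+2 f.
Let J := jacobian_algebra (power_sum_poly_homog hf).

Lemma jacobian_basis_even (d : nat) :
  has_basis (@gcomp J (2 * d)%N%:Z) (d./2.+1 - (d - k)).
Proof.
pose b (i : 'I_(d./2.+1 - (d - k))) := schur (d - k + i) (d - 2 * (d - k + i)).
apply: (@graded_quot_basis graded_poly _ _ _ _ b) => [i|c|u /poly_comp_span[c ->]].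
- have := @schur_comp (d - k + i) (d - 2 * (d - k + i)).
  by have hi := ltn_ord i; rewrite subnK //; lia.
- exact: (schur_indep hf).
exists (fun i => c (d - k + i)%N).
(* Only the terms with b >= d - k are kept; for a dropped one b + m = d - b > k, so it lies in the
   ideal. *)
pose c' (i : nat) : rat := if (i < d - k)%N then 0 else c i.
have -> : \sum_(i < d./2.+1 - (d - k)) c (d - k + i)%N *: b i =
          \sum_(i < d./2.+1) c' i *: schur i (d - 2 * i).
  rewrite (@sum_ord_drop A _ (d - k) (fun i => c' i *: schur i (d - 2 * i))) => [|i hi]; last by rewrite /c' hi scale0r.
  by apply: eq_bigr => i _; rewrite /c' ltnNge leq_addr.
rewrite -sumrB; apply: (big_ind (fun p => p \in jacobian_ideal f)).
- exact: rpred0.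
- by move=> x y; apply: rpredD.
move=> i _; rewrite -scalerBl; have [hi|hi] := ltnP i (d - k).
  by apply: rpredZ; apply: (schur_ideal hf); have := ltn_ord i; lia.
by rewrite /c' ltnNge hi subrr scale0r rpred0.
Qed.

Lemma jacobian_basis_other (j : int) :
  (forall d : nat, j <> (2 * d)%N%:Z) -> has_basis (@gcomp J j) 0.
Proof.
move=> hj; apply: has_basis0 => _ [u /(poly_comp_eq0 hj) -> ->].
exact: raddf0.
Qed.

Lemma dimH0_double_loop (j : int) (d : nat) :
  has_basis (@gcomp J (j - (4 - 2 * k.+2%:Z))) d ->
  dimH (double_loop hf) j 0 = d.
Proof. by move=> h; apply: dimQ_basis; apply: homology0_basis. Qed.

Lemma dimH1_double_loop (j : int) : dimH (double_loop hf) j 1 = 0%N.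
Proof.
apply: dimQ_basis; apply: homology0_basis; apply: has_basis0 => x _.
by rewrite [x]thinmx0.
Qed.

End JacobianDimension.

(** * The Euler characteristic as an explicit finite sum *)

Lemma euler_double_loop (k : nat) (f : A) (hf : power_sum_poly k.+2 f) :
  euler_char (double_loop hf) =
  \sum_(d < (2 * k).+1) (d./2.+1 - (d - k))%:R * qvar ^ ((2 * d)%N%:Z - (2 * k)%N%:Z).
Proof.
pose g (d : nat) : int := (2 * d)%N%:Z - (2 * k)%N%:Z.
have g_inj : injective g by move=> x y; rewrite /g; lia.
(* The shift 4 - 2n equals -2k. *)
have shiftE j : j - (4 - 2 * k.+2%:Z) = j + (2 * k)%N%:Z by lia.
have sumE j : \sum_(l : 'Z_2) (dimH (double_loop hf) j l)%:R * qvar ^ j =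
              (dimH (double_loop hf) j 0)%:R * qvar ^ j.
  rewrite !big_ord_recl big_ord0 addr0 [X in _ + X](_ : _ = 0) ?addr0 //.
  have -> : lift ord0 ord0 = 1 :> 'Z_2 by apply/val_inj.
  by rewrite dimH1_double_loop mul0r.
have dimE d : dimH (double_loop hf) (g d) 0 = (d./2.+1 - (d - k))%N.
  apply: dimH0_double_loop; rewrite shiftE /g subrK.
  exact: jacobian_basis_even.
have ur : uniq [seq g d | d <- index_iota 0 (2 * k).+1].
  by rewrite map_inj_uniq // iota_uniq.
(* Outside the listed degrees the dimension vanishes: either j = g d with d > 2k, where the
   truncated difference is 0, or j + 2k is no even natural number. *)
rewrite /euler_char (fsbigE _ _ ur) // => [|j _ hj].
  rewrite (eq_bigl xpredT) => [|j]; last by rewrite mem_setT.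
  rewrite big_map big_mkord.
  by apply: eq_bigr => d _; rewrite sumE dimE.
rewrite sumE; case: (pselect (exists d, j = g d)) => [[d hd]|nj].
  rewrite hd dimE (_ : _ - _ = 0)%N ?mul0r //.
  have : d \notin index_iota 0 (2 * k).+1.
    by apply: contra hj => hj; rewrite hd; apply: (map_f g hj).
  by rewrite mem_index_iota; lia.
rewrite (dimH0_double_loop (d := 0)) ?mul0r // shiftE.
apply: jacobian_basis_other => d hd; apply: nj; exists d.
by rewrite /g -hd addrK.
Qed.

(** * The Hilbert series and quantum integers *)

(** Passing from k to k + 1 raises the dimension by one exactly for k + 1 <= d <= 2k + 2, which adds
    a geometric sum. The free bound [K] lets one range serve both values of k. *)
Lemma poincare_jacobian (R : comNzRingType) (t : R) (k K : nat) :
  (2 * k < K)%N ->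
  (1 - t) * (1 - t ^+ 2) * (\sum_(d < K) (d./2.+1 - (d - k))%:R * t ^+ d) =
  (1 - t ^+ k.+1) * (1 - t ^+ k.+2).
Proof.
(* The minima cut the window off at [K], so that induction on [K] applies to windows partly out of
   range. *)
have geom a b : (a <= b)%N -> (1 - t) * (\sum_(d < K) (a <= d < b)%:R * t ^+ d) =
    t ^+ minn a K - t ^+ minn b K.
  move=> ab; elim: K => [|K' IH]; first by rewrite big_ord0 !minn0 subrr mulr0.
  rewrite big_ord_recr mulrDr {}IH /=.
  case: (boolP (a <= K')%N) => aK; case: (boolP (K' < b)%N) => Kb /=.
  - have -> : minn a K' = a by lia.
    have -> : minn a K'.+1 = a by lia.
    have -> : minn b K' = K' by lia.
    have -> : minn b K'.+1 = K'.+1 by lia.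
    by rewrite exprS; ring.
  - have -> : minn a K'.+1 = minn a K' by lia.
    have -> : minn b K'.+1 = minn b K' by lia.
    by ring.
  - have -> : minn a K' = minn b K' by lia.
    have -> : minn a K'.+1 = minn b K'.+1 by lia.
    by ring.
  - by exfalso; lia.
elim: k => [|k IH] hK.
  (* For k = 0 only the term d = 0 survives. *)
  case: K {geom} hK => // K _; rewrite big_ord_recl big1 => [|i _].
    by rewrite /= !mul1r addr0 mulr1.
  have -> : ((lift ord0 i)./2.+1 - (lift ord0 i - 0) = 0)%N.
    by rewrite lift0; lia.
  by rewrite mul0r.
have -> : \sum_(d < K) (d./2.+1 - (d - k.+1))%:R * t ^+ d =
    \sum_(d < K) (d./2.+1 - (d - k))%:R * t ^+ d +
    \sum_(d < K) (k.+1 <= d < (2 * k).+3)%:R * t ^+ d.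
  rewrite -big_split; apply: eq_bigr => d _ /=; rewrite -mulrDl -natrD.
  by congr (_%:R * _); case: andP; lia.
rewrite mulrDr IH; last by lia.
rewrite [(1 - t) * _]mulrC -[X in _ + X]mulrA geom; last by lia.
rewrite !(minn_idPl _); try lia.
have -> : t ^+ (2 * k).+3 = t ^+ k * t ^+ k * t ^+ 3.
  by rewrite -!exprD; congr (_ ^+ _); lia.
rewrite !(exprS _ k.+2) !(exprS _ k.+1) !(exprS _ k) ; ring.
Qed.

Lemma qvar_neq0 : qvar != 0.
Proof. by rewrite /qvar tofrac_eq0 polyX_eq0. Qed.

Lemma qvarX_neq1 m : (0 < m)%N -> 1 - qvar ^+ m != 0.
Proof.
move=> m0; rewrite /qvar -tofracXn -tofrac1 -tofracB tofrac_eq0.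
by rewrite -oppr_eq0 opprB -size_poly_eq0 size_XnsubC.
Qed.

(** Apply [poincare_jacobian] with t = q^2; the three nonvanishing conditions clear all
    denominators. *)
Lemma poincare_qint (F : fieldType) (q : F) (k : nat) :
  q != 0 -> 1 - q ^+ 2 != 0 -> 1 - q ^+ 4 != 0 ->
  let qi (m : int) := (q ^ m - q ^ (- m)) / (q - q^-1) in
  \sum_(d < (2 * k).+1) (d./2.+1 - (d - k))%:R * q ^ ((2 * d)%N%:Z - (2 * k)%N%:Z) =
  qi k.+2%:Z * qi (k.+2%:Z - 1) / qi 2.
Proof.
move=> q0 h2 h4 /=.
(* The grading shift contributes the constant factor q^(-2k), leaving a polynomial in q^2. *)
have qE (d : nat) : q ^ ((2 * d)%N%:Z - (2 * k)%N%:Z) = (q ^+ k) ^- 2 * (q ^+ 2) ^+ d.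
  by rewrite expfzDr // -exprnN mulrC -!exprM [(k * 2)%N]mulnC.
under eq_bigr do rewrite qE mulrCA.
rewrite -mulr_sumr.
have := poincare_jacobian (q ^+ 2) (leqnn (2 * k).+1).
rewrite -exprM; move: (\sum_(d < _) _) => P hP.
have -> : P = (1 - (q ^+ 2) ^+ k.+1) * (1 - (q ^+ 2) ^+ k.+2) / ((1 - q ^+ 2) * (1 - q ^+ 4)).
  by rewrite -hP; field; rewrite h2 h4.
have -> : k.+2%:Z - 1 = k.+1%:Z by lia.
have a0 : q ^+ k != 0 by rewrite expf_neq0.
rewrite -!exprnN -!exprnP -!exprM !(mulnC 2) !exprM !(exprS q k.+1) !(exprS q k).
(* With q^k replaced by a free nonzero [a], a rational identity in [a] and [q] remains. *)
move: (q ^+ k) a0 => a a0; field; rewrite a0 q0 -expr2 -exprM.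
by rewrite -(opprB 1 (q ^+ 2)) -(opprB 1 (q ^+ 4)) !oppr_eq0 h2 h4.
Qed.

Theorem corollary3p6 (n : nat) (f : {mpoly rat[2]}) (hn : (3 <= n)%N)
    (hf : power_sum_poly n f) :
  euler_char (double_loop hf) = qint n%:Z * qint (n%:Z - 1) / qint 2.
Proof.
case: n hn hf => [|[|k]] // _ hf; rewrite euler_double_loop.
by apply: poincare_qint; [exact: qvar_neq0 | exact: qvarX_neq1 ..].
Qed.
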